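(* Let $k$ be a field of characteristic zero, let $x=(x_1,\dots,x_n)$ be $n$ commutative free variables, and let $k(x)$ be the field of fractions of the polynomial algebra $k[x]$. Then the LFED Conjecture holds for $k(x)$; that is: for every locally finite $k$-derivation $D$ of $k(x)$, the image $\operatorname{Im} D$ is a Mathieu-Zhao space of $k(x)$, and for every locally finite $k\mathcal{E}$-derivation $\delta$ of $k(x)$, the image $\operatorname{Im}\delta$ is a Mathieu-Zhao space of $k(x)$.
   Context: Let $\mathcal{A}$ be a commutative $k$-algebra. A $k$-derivation of $\mathcal{A}$ is a $k$-linear map $D:\mathcal{A}\to\mathcal{A}$ with $D(ab)=D(a)b+aD(b)$ for all $a,b\in\mathcal{A}$. A $k\mathcal{E}$-derivation of $\mathcal{A}$ is a map of the form $\delta=1-\phi$, where $1$ is the identity map of $\mathcal{A}$ and $\phi$ is a $k$-algebra endomorphism of $\mathcal{A}$. A $k$-linear map $T:\mathcal{A}\to\mathcal{A}$ is locally finite if for each $a\in\mathcal{A}$ the $k$-subspace spanned by the elements $T^m(a)$ ($m\ge 0$) is finite dimensional over $k$. For a $k$-subspace $M$ of $\mathcal{A}$, the radical $\mathfrak{r}(M)$ is the set of $a\in\mathcal{A}$ such that $a^m\in M$ for all sufficiently large $m$. The subspace $M$ is a Mathieu-Zhao space (MZ-space) of $\mathcal{A}$ if for every $a\in\mathfrak{r}(M)$ and every $b\in\mathcal{A}$ there exists $N_b\ge 1$ such that $ba^m\in M$ for all $m\ge N_b$. *)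

(* Defs.v *)
From HB Require Import structures.
From mathcomp Require Import all_boot all_order all_algebra.
From mathcomp Require Import mpoly.

Set Implicit Arguments.
Unset Strict Implicit.
Unset Printing Implicit Defensive.

Import GRing.Theory.
Local Open Scope ring_scope.

Section LFED.
Variables (k : fieldType) (A : comAlgType k).

(* Subsets of A are Prop-valued predicates: membership in the image of a map
   or in a span is not decidable in general. *)
Implicit Types (S M V : A -> Prop) (T : {linear A -> A}).

Definition is_subspace M : Prop :=
  M 0 /\ (forall (c : k) (u v : A), M u -> M v -> M (c *: u + v)).

Definition lin_span S : A -> Prop := fun v =>
  exists (r : nat) (c : 'I_r -> k) (w : 'I_r -> A),
    (forall i, S (w i)) /\ v = \sum_(i < r) c i *: w i.

Definition finite_dimensional V : Prop :=
  exists (r : nat) (b : 'I_r -> A),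
    (forall i, V (b i)) /\
    (forall v, V v -> exists c : 'I_r -> k, v = \sum_(i < r) c i *: b i).

Definition lin_image T : A -> Prop := fun v => exists u, T u = v.

Definition locally_finite T : Prop :=
  forall a : A, finite_dimensional (lin_span (fun v => exists m, v = iter m T a)).

Definition is_derivation T : Prop :=
  forall a b : A, T (a * b) = T a * b + a * T b.

Definition is_Ederivation T : Prop :=
  exists phi : {lrmorphism A -> A}, forall a, T a = a - phi a.

Definition radical M : A -> Prop := fun a =>
  exists N : nat, forall m, (N <= m)%N -> M (a ^+ m).

Definition MZ_space M : Prop :=
  is_subspace M /\
  (forall a b : A, radical M a ->
     exists N : nat, (1 <= N)%N /\ forall m, (N <= m)%N -> M (b * a ^+ m)).

Definition LFED_conjecture : Prop :=
  (forall D : {linear A -> A},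
     is_derivation D -> locally_finite D -> MZ_space (lin_image D)) /\
  (forall delta : {linear A -> A},
     is_Ederivation delta -> locally_finite delta -> MZ_space (lin_image delta)).

End LFED.

Definition ratfun (k : fieldType) (n : nat) : Type := {fraction {mpoly k[n]}}.

(* [{fraction _}] carries no algebra structure in the library; c : k acts on
   k(x) through its image as a constant polynomial. *)
Section RatfunAlgebra.
Variables (k : fieldType) (n : nat).

HB.instance Definition _ := GRing.Field.on (ratfun k n).

Definition ratfunC (c : k) : ratfun k n := tofrac (c%:MP_[n]).

Definition ratfun_scale (c : k) (f : ratfun k n) : ratfun k n := ratfunC c * f.

Fact ratfun_scaleA a b f :
  ratfun_scale a (ratfun_scale b f) = ratfun_scale (a * b) f.
Proof. by rewrite /ratfun_scale /ratfunC mpolyCM tofracM mulrA. Qed.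

Fact ratfun_scale1 : left_id 1 ratfun_scale.
Proof. by move=> f; rewrite /ratfun_scale /ratfunC mpolyC1 tofrac1 mul1r. Qed.

Fact ratfun_scaleDr : right_distributive ratfun_scale +%R.
Proof. by move=> a f g; rewrite /ratfun_scale mulrDr. Qed.

Fact ratfun_scaleDl f : {morph ratfun_scale^~ f : a b / a + b}.
Proof.
by move=> a b; rewrite /ratfun_scale /ratfunC mpolyCD tofracD mulrDl.
Qed.

HB.instance Definition _ := GRing.Zmodule_isLmodule.Build k (ratfun k n)
  ratfun_scaleA ratfun_scale1 ratfun_scaleDr ratfun_scaleDl.

Fact ratfun_scaleAl (a : k) (f g : ratfun k n) : a *: (f * g) = (a *: f) * g.
Proof. exact: mulrA. Qed.

HB.instance Definition _ :=
  GRing.Lmodule_isLalgebra.Build k (ratfun k n) ratfun_scaleAl.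

Fact ratfun_scaleAr (a : k) (f g : ratfun k n) : a *: (f * g) = f * (a *: g).
Proof. exact: mulrCA. Qed.

HB.instance Definition _ :=
  GRing.Lalgebra_isAlgebra.Build k (ratfun k n) ratfun_scaleAr.

End RatfunAlgebra.

(* Main.v *)
From HB Require Import structures.
Require Import Defs.
From mathcomp Require Import all_boot all_order all_algebra.
From mathcomp Require Import generic_quotient mpoly ring.
From Stdlib Require Import Classical.

Set Implicit Arguments.
Unset Strict Implicit.
Unset Printing Implicit Defensive.

Import GRing.Theory.
Local Open Scope ring_scope.

(** Local finiteness is a very strong condition on a field, because it bounds
    poles: all the elements of an orbit lie in a finite-dimensional space of
    rational functions, so they have a common denominator
    ([common_denominator]).  Applied to the orbits of inverses, this forces the
    image of the map to have radical zero, and such a subspace is trivially a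
    Mathieu-Zhao space.

    A locally finite derivation [D] is zero.  Otherwise some [D x_i] is nonzero,
    and for almost every natural number [t], seen in [k], both [D x_i] is a unit
    in the local ring of the hyperplane [x_i = t] and [D] preserves this ring.
    Then the iterated derivatives of [1 / (x_i - t)] have poles of orders 1, 2,
    3 and so on along this hyperplane ([pole_order_iter_deriv]), and they cannot
    have a common denominator ([unbounded_poles]).

    For [delta = 1 - phi], local finiteness of [delta] means that of [phi], and
    it forces every [phi]-orbit to be finite ([orbit_finite]).  Write the orbit
    of [a] as [p_i / q]; the orbits of [1 / a] and [1 / (a - 1)] have common
    denominators too, so all the [p_i] divide one nonzero polynomial and all the
    [p_i - q] another one.  A polynomial has finitely many divisors up to
    constants ([mpoly_divisor_coloring], by Kronecker's substitution and gcds in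
    one variable), so two members of the orbit are proportional over [k] and
    remain so after subtracting 1; they must be equal or constant.

    If now [a ^+ m] lies in the image of [1 - phi] for all large [m], taking the
    trace over a common period shows that the [m]-th power sum of the orbit of
    [a] vanishes for all large [m]; in characteristic zero this means [a = 0]
    ([eq0_of_powers_in_image]). *)

(** * Divisors of a polynomial up to constants *)

Lemma pigeonhole_nat (I : finType) (f : nat -> I) :
  exists i j, (i < j)%N /\ f i = f j.
Proof.
pose g (i : 'I_(#|I|.+1)) := f i.
have [/leq_card|/injectivePn[i [j neq_ij eq_g]]] := altP (@injectiveP _ _ g).
  by rewrite card_ord ltnn.
have [lt_ij|lt_ji|/val_inj eq_ij] := ltngtP i j; first by exists i, j.
  by exists j, i.
by rewrite eq_ij eqxx in neq_ij.
Qed.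

(** A nonzero polynomial has only finitely many divisors up to constants.  The
    finiteness is phrased as a finite colouring that separates the classes of
    divisors, which is the form in which the pigeonhole principle uses it.
    Unique factorization is avoided: if [p = r * q] with [q] proper, a divisor
    [d] of [p] is the product of [gcdp d q], which divides [q], and of its
    cofactor, which divides [r], so the pair of their colours determines [d];
    if [p] has no proper factor, its divisors are the constants and the
    multiples of [p] by constants. *)
Lemma poly_divisor_coloring (F : fieldType) (p : {poly F}) : p != 0 ->
  exists (I : finType) (col : {poly F} -> I),
    forall d e, d %| p -> e %| p -> col d = col e -> d %= e.
Proof.
have [s] := ubnP (size p); elim: s p => // s IHs p; rewrite ltnS => le_ps nz_p.
have [[q [q_p q_gt1 lt_qp]]|irr_p] :=
  classic (exists q, [/\ q %| p, (1 < size q)%N & (size q < size p)%N]).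
  have nz_q : q != 0 by rewrite -size_poly_gt0 ltnW.
  pose r := p %/ q; have def_p : p = r * q by rewrite divpK.
  have nz_r : r != 0 by apply: contraNneq nz_p => r0; rewrite def_p r0 mul0r.
  have lt_rp : (size r < size p)%N.
    rewrite def_p size_mul //; case: (size q) q_gt1 => [|[|t]] // _.
    by rewrite !addnS ltnS leq_addr.
  have [I [colq colqP]] := IHs q (leq_trans lt_qp le_ps) nz_q.
  have [J [colr colrP]] := IHs r (leq_trans lt_rp le_ps) nz_r.
  exists (I * J)%type, (fun d => (colq (gcdp d q), colr (d %/ gcdp d q))).
  (* With [g := gcdp d q], [d %/ g] divides [r * (q %/ g)] and is coprime to [q %/ g]. *)
  have cofactor d : d %| p -> d %/ gcdp d q %| r.
    move=> d_p; have nz_g : gcdp d q != 0 by rewrite gcdp_eq0 (negPf nz_q) andbF.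
    have co_dq : coprimep (d %/ gcdp d q) (q %/ gcdp d q).
      by rewrite coprimep_div_gcd // nz_q orbT.
    rewrite -(Gauss_dvdpl _ co_dq) -(dvdp_mul2r _ _ nz_g) divpK ?dvdp_gcdl //.
    by rewrite -mulrA divpK ?dvdp_gcdr // -def_p.
  move=> d e d_p e_p [/colqP eq_g /colrP eq_c].
  rewrite -[d](divpK (dvdp_gcdl d q)) -[e](divpK (dvdp_gcdl e q)).
  apply: (eqp_trans (eqp_mulr _ (eq_c _ _))) (eqp_mull _ (eq_g _ _));
    rewrite ?dvdp_gcdr ?cofactor //.
exists bool, (fun d => size d == 1%N).
have eqp_p d : d %| p -> size d != 1%N -> d %= p.
  move=> d_p d_n1; rewrite -(dvdp_size_eqp d_p) eqn_leq (dvdp_leq nz_p d_p) leqNgt.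
  apply/negP => lt_dp; apply: irr_p; exists d; split=> //.
  rewrite ltn_neqAle eq_sym d_n1 size_poly_gt0.
  by apply: contraNneq nz_p => d0; rewrite -dvd0p -d0.
move=> d e d_p e_p eq_col; have [d1|d_n1] := eqVneq (size d) 1%N.
  have e1 : size e == 1%N by rewrite -eq_col d1.
  move: d1 e1 => /eqP; rewrite !size_poly_eq1 => d1 e1.
  by rewrite (eqp_trans d1) // eqp_sym.
have e_n1 : size e != 1%N by rewrite -eq_col.
by rewrite (eqp_trans (eqp_p d d_p d_n1)) // eqp_sym eqp_p.
Qed.

Lemma digits_inj B n (a b : 'I_n -> nat) :
  (forall i, (a i < B)%N) -> (forall i, (b i < B)%N) ->
  (\sum_(i < n) a i * B ^ i = \sum_(i < n) b i * B ^ i)%N -> a =1 b.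
Proof.
elim: n a b => [|n IHn] a b ltaB ltbB; first by move=> _ [].
rewrite !big_ord_recl !expn0 !muln1.
have shift (c : 'I_n.+1 -> nat) :
  (\sum_(i < n) c (lift ord0 i) * B ^ lift ord0 i
   = (\sum_(i < n) c (lift ord0 i) * B ^ i) * B)%N.
  by rewrite big_distrl; apply: eq_bigr => i _; rewrite /= expnSr mulnA.
rewrite !shift => eq_ab.
have B_gt0 : (0 < B)%N by apply: leq_ltn_trans (ltaB ord0).
have eq0 : a ord0 = b ord0.
  have := congr1 (modn^~ B) eq_ab.
  by rewrite ![(_ + _ * B)%N]addnC !modnMDl !modn_small.
move: eq_ab; rewrite eq0 => /addnI/eqP; rewrite eqn_pmul2r // => /eqP eqS i.
have [j ->|->//] := unliftP ord0 i.
exact: (IHn (fun i => a (lift ord0 i)) (fun i => b (lift ord0 i))).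
Qed.

Section Kronecker.
Variables (k : fieldType) (n : nat).

(** Kronecker's substitution, which reads the exponents of a monomial as the
    digits of a number in base [B]. *)
Definition kronecker (B : nat) : {mpoly k[n]} -> {poly k} :=
  mmap (@polyC k) (fun i : 'I_n => 'X^(B ^ i)).

HB.instance Definition _ B := GRing.RMorphism.on (kronecker B).

(** When all the exponents of [p] are digits in base [B], distinct monomials
    of [p] are sent to distinct powers of the variable, and nothing cancels. *)
Lemma kronecker_neq0 B p : (msize p <= B)%N -> p != 0 -> kronecker B p != 0.
Proof.
move=> lepB nz_p; pose e (m : 'X_{1..n}) := (\sum_(i < n) m i * B ^ i)%N.
have kronE : kronecker B p = \sum_(m <- msupp p) p@_m *: 'X^(e m).
  apply: eq_bigr => m _; rewrite mul_polyC; congr (_ *: _).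
  rewrite /e -prodrXr; apply: eq_bigr => i _.
  by rewrite -exprM mulnC.
have digit_lt m : m \in msupp p -> forall i, (m i < B)%N.
  move=> /msize_mdeg_lt lt_mp i; apply: leq_trans lepB; apply: leq_ltn_trans lt_mp.
  by rewrite mdegE (bigD1 i) //= leq_addr.
have supp_m := mlead_supp nz_p.
suff: (kronecker B p)`_(e (mlead p)) != 0 by apply: contraNneq => ->; rewrite coef0.
rewrite kronE coef_sum (bigD1_seq (mlead p)) ?msupp_uniq //= coefZ coefXn eqxx mulr1.
rewrite big_seq_cond big1 ?addr0 ?mleadc_eq0 // => m /andP[m_p neq_m].
rewrite coefZ coefXn; case: eqP => [eq_e|]; last by rewrite mulr0.
case/eqP: neq_m; apply/mnmP => i; apply: (digits_inj _ _ (esym eq_e)); exact: digit_lt.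
Qed.

(** Since a divisor of [F] has at most the degree of [F], one Kronecker
    substitution is injective on linear combinations of divisors of [F]; the
    univariate colouring of the image of [F] then works for [F]. *)
Lemma mpoly_divisor_coloring (F : {mpoly k[n]}) : F != 0 ->
  exists (I : finType) (col : {mpoly k[n]} -> I), forall d e r s,
    F = r * d -> F = s * e -> col d = col e -> exists c : k, d = c *: e.
Proof.
move=> nz_F; pose B := msize F.
have /poly_divisor_coloring[I [col colP]] := kronecker_neq0 (leqnn B) nz_F.
exists I, (col \o kronecker B) => d e r s Fd Fe eq_col.
have size_divisor t q : F = t * q -> (msize q <= B)%N.
  move=> Fq; move: (nz_F); rewrite Fq mulf_eq0 negb_or => /andP[nz_t nz_q].
  by rewrite /B Fq msizeM // -subn1 leq_subRL ?leq_add2r ?addn_gt0 // lt0n msize_poly_eq0 ?nz_t.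
have dvd_kron t q : F = t * q -> kronecker B q %| kronecker B F.
  by move=> ->; rewrite rmorphM dvdp_mull.
have /eqpP[[c1 c2] /= /andP[nz1 _] eq_de] :=
  colP _ _ (dvd_kron _ _ Fd) (dvd_kron _ _ Fe) eq_col.
exists (c1^-1 * c2).
rewrite -scalerA; apply: (canRL (scalerK nz1)).
have kronZ c q : kronecker B (c *: q) = c *: kronecker B q.
  by rewrite /kronecker mmapZ mul_polyC.
apply/eqP; rewrite -subr_eq0; apply/negPn/negP => nz_diff.
suff /kronecker_neq0/(_ nz_diff) : (msize (c1 *: d - c2 *: e) <= B)%N.
  by rewrite rmorphB /= !kronZ eq_de subrr eqxx.
rewrite (leq_trans (msizeD_le _ _)) // msizeN geq_max.
by rewrite !(leq_trans (msizeZ_le _ _)) ?(size_divisor _ _ Fd) ?(size_divisor _ _ Fe).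
Qed.

End Kronecker.

(** * Spans of orbits *)

Section LinearSpan.
Variables (k : fieldType) (A : comAlgType k).
Implicit Types (S : A -> Prop) (T : {linear A -> A}).

Lemma lin_span_incl S v : S v -> lin_span S v.
Proof.
by move=> Sv; exists 1%N, (fun=> 1), (fun=> v); split; rewrite // big_ord1 scale1r.
Qed.

Lemma lin_spanB S u v : lin_span S u -> lin_span S v -> lin_span S (u - v).
Proof.
move=> [r [c [w [Sw ->]]]] [s [d [z [Sz ->]]]].
exists (r + s)%N, (fun i => match split i with inl i => c i | inr i => - d i end),
  (fun i => match split i with inl i => w i | inr i => z i end); split.
  by move=> i; case: splitP.
rewrite big_split_ord /= -sumrN; congr (_ + _); apply: eq_bigr => i _.
  case: splitP => [j /= /ord_inj -> //|j /= eq_ij].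
  by have := ltn_ord i; rewrite eq_ij ltnNge leq_addr.
case: splitP => [j /= eq_ij|j /= /addnI/ord_inj ->]; last by rewrite scaleNr.
by have := ltn_ord j; rewrite -eq_ij ltnNge leq_addr.
Qed.

Lemma lin_span_orbit_stable T a v :
  lin_span (fun v => exists m, v = iter m T a) v ->
  lin_span (fun v => exists m, v = iter m T a) (T v).
Proof.
move=> [r [c [w [Sw ->]]]]; exists r, c, (T \o w); split=> [i|].
  by have [m wi] := Sw i; exists m.+1; rewrite iterS -wi.
by rewrite linear_sum; apply: eq_bigr => i _; rewrite linearZ.
Qed.

Lemma lin_image_subspace T : is_subspace (lin_image T).
Proof.
split=> [|c _ _ [u <-] [v <-]]; first by exists 0; rewrite raddf0.
by exists (c *: u + v); rewrite linearP.
Qed.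

End LinearSpan.

(** * Common denominators in k(x) *)

Lemma fracfield_ratioP (R : idomainType) (u : {fraction R}) :
  exists p q : R, q != 0 /\ u = FracField.tofrac p / FracField.tofrac q.
Proof.
elim/quotW: u => x; exists (frac x).1, (frac x).2.
have nz_d := denom_ratioP x; split=> //.
apply: (canRL (mulfK _)); first by rewrite tofrac_eq0.
unlock FracField.tofrac; rewrite -[LHS]FracField.pi_mul.
apply/eqmodP; rewrite /= FracField.equivfE /FracField.mulf.
by rewrite !numden_Ratio ?mulf_neq0 ?oner_neq0 // !mulr1 mulrC.
Qed.

Lemma family_common_denominator (R : idomainType) (F : fieldType)
    (emb : {rmorphism R -> F}) (r : nat) (b : 'I_r -> F) :
    injective emb -> (forall u, exists p q, q != 0 /\ u = emb p / emb q) ->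
  exists2 q, q != 0 & forall i, exists p, b i = emb p / emb q.
Proof.
move=> emb_inj emb_frac.
have emb_eq0 p : (emb p == 0) = (p == 0) by rewrite -(inj_eq emb_inj) rmorph0.
elim: r b => [|r IHr] b; first by exists 1; rewrite ?oner_neq0 // => -[].
have [q nz_q denQ] := IHr (b \o lift ord0).
have [p0 [q0 [nz_q0 b0]]] := emb_frac (b ord0).
exists (q0 * q) => [|i]; first by rewrite mulf_neq0.
have [j ->|->] := unliftP ord0 i; [have [p /= ->] := denQ j | rewrite b0].
  by exists (q0 * p); rewrite !rmorphM invfM mulrACA divff ?mul1r ?emb_eq0.
by exists (p0 * q); rewrite !rmorphM invfM mulrACA divff ?mulr1 ?emb_eq0.
Qed.

Section Fractions.
Variables (k : fieldType) (n : nat).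
Implicit Types (p q : {mpoly k[n]}) (u v : ratfun k n).

(** [tofrac] with codomain [ratfun k n], so that the algebra structure of
    [ratfun k n] is found on its values. *)
Definition frac_of : {mpoly k[n]} -> ratfun k n := @FracField.tofrac _.

HB.instance Definition _ :=
  GRing.isZmodMorphism.Build _ _ frac_of (@tofrac_is_zmod_morphism _).
HB.instance Definition _ :=
  GRing.isMonoidMorphism.Build _ _ frac_of (@tofrac_is_monoid_morphism _).

Lemma frac_of_eq0 p : (frac_of p == 0) = (p == 0).
Proof. exact: tofrac_eq0. Qed.

Lemma frac_of_inj : injective frac_of.
Proof. by move=> p q /eqP; rewrite /frac_of tofrac_eq => /eqP. Qed.

Lemma frac_ofZ c p : frac_of (c *: p) = c *: frac_of p.
Proof. by rewrite -mul_mpolyC rmorphM. Qed.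

Lemma ratfunP u : exists p q, q != 0 /\ u = frac_of p / frac_of q.
Proof. exact: fracfield_ratioP. Qed.

(** This is how local finiteness is used throughout: along an orbit the
    denominators, hence the poles, are bounded. *)
Lemma common_denominator (V : ratfun k n -> Prop) : finite_dimensional V ->
  exists2 q, q != 0 & forall v, V v -> exists p, v = frac_of p / frac_of q.
Proof.
move=> [r [b [_ spanV]]].
have [q nz_q denQ] : exists2 q, q != 0 & forall i, exists p, b i = frac_of p / frac_of q.
  exact: (family_common_denominator b frac_of_inj ratfunP).
exists q => // v /spanV[c ->]; elim/big_rec: _ => [|i _ _ [p ->]].
  by exists 0; rewrite rmorph0 mul0r.
have [pi ->] := denQ i; exists (c i *: pi + p).
by rewrite rmorphD /= frac_ofZ mulrDl scalerAl.
Qed.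

Hypothesis char_k : [pchar k] =i pred0.

Lemma ratfun_natr_eq0 m : (m%:R == 0 :> ratfun k n) = (m == 0%N).
Proof.
rewrite -(rmorph_nat frac_of) frac_of_eq0 -(rmorph_nat (@mpolyC n k)).
by rewrite mpolyC_eq0; move/pcharf0P: char_k.
Qed.

End Fractions.

(** * Finiteness of the orbits of a locally finite endomorphism *)

Section Iterates.
Variables (F : fieldType) (f : {rmorphism F -> F}).

Lemma iter_mul_fixed (T : Type) (g : T -> T) L q a :
  iter L g a = a -> iter (q * L) g a = a.
Proof. by move=> gLa; elim: q => // q IHq; rewrite mulSn iterD IHq. Qed.

Lemma iter_fmorphXn i a m : iter i f (a ^+ m) = iter i f a ^+ m.
Proof. by elim: i => //= i ->; rewrite rmorphXn. Qed.

Lemma iter_fmorphB i a b : iter i f (a - b) = iter i f a - iter i f b.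
Proof. by elim: i => //= i ->; rewrite rmorphB. Qed.

Lemma iter_fmorphV i a : iter i f a^-1 = (iter i f a)^-1.
Proof. by elim: i => //= i ->; rewrite fmorphV. Qed.

Lemma iter_fmorph1 i : iter i f 1 = 1.
Proof. by elim: i => //= i ->; rewrite rmorph1. Qed.

Lemma iter_fmorph_inj i : injective (iter i f).
Proof. by elim: i => [|i IHi] u v //= /fmorph_inj/IHi. Qed.

Lemma iter_fmorph_eq0 i a : (iter i f a == 0) = (a == 0).
Proof. by elim: i => //= i <-; rewrite fmorph_eq0. Qed.

End Iterates.

Section FiniteOrbits.
Variables (k : fieldType) (n : nat) (F : fieldType).
Variables (emb : {rmorphism {mpoly k[n]} -> F}) (f : {rmorphism F -> F}).
Hypothesis emb_inj : injective emb.
Hypothesis f_const : forall c, f (emb c%:MP) = emb c%:MP.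
Hypothesis denom_orbit : forall a,
  exists2 q, q != 0 & forall i, exists p, iter i f a = emb p / emb q.

(** Let [q] be a common denominator of the orbit [a_i = p_i / q] of [a].  As
    the orbits of [a^-1] and of [(a - 1)^-1] have common denominators [s0] and
    [s1], every [p_i] divides [q * s0] and every [p_i - q] divides [q * s1].
    These have finitely many divisors up to constants, so there are [i < j]
    with [a_i = c * a_j] and [a_i - 1 = d * (a_j - 1)] for constants [c], [d].
    Eliminating [a_i] gives [(c - d) * a_j = 1 - d]: either [c = d = 1] and
    [a_i = a_j], or [a_j] is a constant, fixed by [f].  In both cases the orbit
    of [a] repeats, and [f] is injective. *)
Lemma orbit_finite a : exists2 L, (0 < L)%N & iter L f a = a.
Proof.
(* [0] and [1] are fixed by [f]; otherwise [a] and [a - 1] are invertible. *)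
have [->|nz_a] := eqVneq a 0; first by exists 1%N; rewrite //= rmorph0.
have [->|a_n1] := eqVneq a 1; first by exists 1%N; rewrite //= rmorph1.
have emb_eq0 p : (emb p == 0) = (p == 0) by rewrite -(inj_eq emb_inj) rmorph0.
have [q nz_q denQ] := denom_orbit a.
have [s0 nz_s0 den0] := denom_orbit a^-1.
have [s1 nz_s1 den1] := denom_orbit (a - 1)^-1.
have [I [col0 col0P]] := mpoly_divisor_coloring (mulf_neq0 nz_q nz_s0).
have [J [col1 col1P]] := mpoly_divisor_coloring (mulf_neq0 nz_q nz_s1).
have Ep i : exists p, iter i f a == emb p / emb q.
  by have [p /eqP] := denQ i; exists p.
pose p i := xchoose (Ep i).
have ap i : iter i f a = emb (p i) / emb q by apply/eqP/(xchooseP (Ep i)).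
have nz_fq : emb q != 0 by rewrite emb_eq0.
have iterB1 i : iter i f (a - 1) = iter i f a - 1.
  by rewrite iter_fmorphB iter_fmorph1.
have ap1 i : iter i f a - 1 = emb (p i - q) / emb q.
  by rewrite rmorphB mulrBl divff // ap.
have nz_p i : p i != 0.
  move: nz_a; rewrite -(iter_fmorph_eq0 f i); apply: contraNneq => p0.
  by rewrite ap p0 rmorph0 mul0r.
have nz_p1 i : p i - q != 0.
  move: a_n1; rewrite -subr_eq0 -(iter_fmorph_eq0 f i); apply: contraNneq => p0.
  by rewrite iterB1 ap1 p0 rmorph0 mul0r.
have inv_divides t s r : t != 0 -> s != 0 ->
    (emb t / emb q)^-1 = emb r / emb s -> q * s = r * t.
  move=> nz_t nz_s; rewrite invf_div => /eqP.
  by rewrite eqr_div ?emb_eq0 // -!rmorphM => /eqP/emb_inj.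
have p_dvd i : exists r, q * s0 = r * p i.
  have [r ar] := den0 i; exists r; apply: inv_divides => //.
  by rewrite -ap -iter_fmorphV.
have p1_dvd i : exists r, q * s1 = r * (p i - q).
  have [r ar] := den1 i; exists r; apply: inv_divides => //.
  by rewrite -ap1 -iterB1 -iter_fmorphV.
have [i [j [lt_ij [eq0 eq1]]]] :=
  pigeonhole_nat (fun i => (col0 (p i), col1 (p i - q))).
have [[ri Di] [rj Dj]] := (p_dvd i, p_dvd j).
have [ti Ei] := p1_dvd i; have [tj Ej] := p1_dvd j.
have [c pc] := col0P _ _ _ _ Di Dj eq0.
have [d pd] := col1P _ _ _ _ Ei Ej eq1.
pose C (x : k) := emb x%:MP.
have ac : iter i f a = C c * iter j f a.
  by rewrite !ap pc -mul_mpolyC rmorphM mulrA.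
have ad : iter i f a - 1 = C d * (iter j f a - 1).
  by rewrite !ap1 pd -mul_mpolyC rmorphM mulrA.
have rel : (C c - C d) * iter j f a = 1 - C d.
  by rewrite mulrBl -ac; move/eqP: ad; rewrite mulrBr mulr1 subr_eq => /eqP->; ring.
have period h l : (h < l)%N -> iter h f a = iter l f a ->
    exists2 L, (0 < L)%N & iter L f a = a.
  move=> lt_hl; rewrite -{1}(subnKC (ltnW lt_hl)) iterD => /iter_fmorph_inj a_per.
  by exists (l - h)%N; rewrite ?subn_gt0.
have [eq_cd|neq_cd] := eqVneq (C c) (C d).
  apply: (period i j) => //; move/eqP: rel.
  rewrite eq_cd subrr mul0r eq_sym subr_eq0 => /eqP d1.
  by rewrite ac eq_cd -d1 mul1r.
apply: (period j j.+1) => //=.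
have nz_cd : C c - C d != 0 by rewrite subr_eq0.
have -> : iter j f a = (C c - C d)^-1 * (1 - C d) by rewrite -rel mulKf.
by rewrite rmorphM fmorphV !rmorphB /= !f_const rmorph1.
Qed.

End FiniteOrbits.

Section Endomorphism.
Variables (k : fieldType) (n : nat).
Local Notation K := (ratfun k n).
Variables (delta : {linear K -> K}) (phi : {lrmorphism K -> K}).
Hypothesis deltaE : forall a, delta a = a - phi a.
Hypothesis lf_delta : locally_finite delta.

Lemma locally_finite_orbit_denominator a :
  exists2 q, q != 0 & forall i, exists p, iter i phi a = frac_of p / frac_of q.
Proof.
have [q nz_q denQ] := common_denominator (lf_delta a).
(* As [phi = 1 - delta], the orbits under [phi] and [delta] span the same space. *)
exists q => // i; apply: denQ; elim: i => [|i IHi].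
  by apply: lin_span_incl; exists 0%N.
have -> : iter i.+1 phi a = iter i phi a - delta (iter i phi a).
  by rewrite deltaE subKr.
exact/lin_spanB/lin_span_orbit_stable.
Qed.

Lemma Ederivation_orbit_finite a : exists2 L, (0 < L)%N & iter L phi a = a.
Proof.
apply: (@orbit_finite k n K (@frac_of k n) phi) => [||b].
- exact: frac_of_inj.
- move=> c; have const_c : frac_of c%:MP_[n] = c *: (1 : K) by rewrite [RHS]mulr1.
  apply: etrans (congr1 phi const_c) (etrans _ (esym const_c)).
  by rewrite linearZ rmorph1.
exact: locally_finite_orbit_denominator.
Qed.

End Endomorphism.

(** * Images of locally finite E-derivations *)

(** In characteristic zero the power sums determine the nonzero elements of a
    family: the hypothesis gives [\sum_i b i ^+ N * p.[b i] = 0] for every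
    polynomial [p], and a [p] that vanishes at all the values of [b] other than
    [b i0] leaves a nonzero multiple of [b i0 ^+ N]. *)
Lemma power_sums_eq0 (F : fieldType) (I : finType) (b : I -> F) (N : nat) :
    [pchar F] =i pred0 -> (forall m, (N <= m)%N -> \sum_i b i ^+ m = 0) ->
  forall i, b i = 0.
Proof.
move=> char_F sum0 i0.
have sum_horner (p : {poly F}) : \sum_i b i ^+ N * p.[b i] = 0.
  under eq_bigr do rewrite horner_coef mulr_sumr.
  rewrite exchange_big big1 // => j _.
  under eq_bigr do rewrite mulrCA -exprD.
  by rewrite -mulr_sumr sum0 ?mulr0 // leq_addr.
pose s := [seq x <- codom b | x != b i0].
pose p := \prod_(x <- s) ('X - x%:P).
have nz_p : p.[b i0] != 0.
  by rewrite -/(root p (b i0)) root_prod_XsubC mem_filter eqxx.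
have := sum_horner p; rewrite (bigID (fun i => b i == b i0)) /= addrC big1 ?add0r.
  rewrite (eq_bigr (fun=> b i0 ^+ N * p.[b i0])) => [|i /eqP-> //].
  rewrite sumr_const -mulr_natr => /eqP; rewrite !mulf_eq0 (negPf nz_p) orbF.
  move/pcharf0P: char_F => ->; case/orP=> [|/pred0P/(_ i0)].
    by rewrite expf_eq0 => /andP[_ /eqP].
  by move/(etrans (esym (eqxx (b i0)))).
move=> i neq_bi; suff /rootP-> : root p (b i) by rewrite mulr0.
by rewrite root_prod_XsubC mem_filter neq_bi codom_f.
Qed.

(** Summing over a full period is a trace, which kills [u - f u].  If [L] is a
    period of [a] and [M] one of [u], the trace over [M * L] of
    [a ^+ m = u - f u] is [M] times the [m]-th power sum of the orbit of [a],
    so these power sums vanish from some [m] on. *)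
Lemma eq0_of_powers_in_image (F : fieldType) (f : {rmorphism F -> F}) (N : nat) a :
    [pchar F] =i pred0 ->
    (forall u, exists2 L, (0 < L)%N & iter L f u = u) ->
    (forall m, (N <= m)%N -> exists u, a ^+ m = u - f u) ->
  a = 0.
Proof.
move=> char_F per im_a; have [L L_gt0 fL] := per a.
have sum0 m : (N <= m)%N -> \sum_(i < L) iter i f a ^+ m = 0.
  move=> /im_a[u def_am]; have [M M_gt0 fM] := per u.
  have trace t : \sum_(i < t) iter i f (a ^+ m) = u - iter t f u.
    elim: t => [|t IHt]; first by rewrite big_ord0 subrr.
    by rewrite big_ord_recr IHt /= def_am iter_fmorphB -iterSr addrA subrK.
  have trace_mul t : \sum_(i < t * L) iter i f (a ^+ m)
      = (\sum_(i < L) iter i f a ^+ m) *+ t.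
    elim: t => [|t IHt]; first by rewrite big_ord0.
    rewrite mulSnr big_split_ord IHt mulrSr; congr (_ + _).
    apply: eq_bigr => i _; rewrite iter_fmorphXn /= addnC iterD.
    by rewrite (iter_mul_fixed _ fL).
  have := trace (M * L)%N.
  rewrite trace_mul mulnC (iter_mul_fixed _ fM) subrr -mulr_natr => /eqP.
  rewrite mulf_eq0; move/pcharf0P: char_F => ->.
  by rewrite (gtn_eqF M_gt0) orbF => /eqP.
exact: (power_sums_eq0 char_F sum0 (Ordinal L_gt0)).
Qed.

Section ImageOfEderivation.
Variables (k : fieldType) (n : nat).
Hypothesis char_k : [pchar k] =i pred0.
Local Notation K := (ratfun k n).

Lemma pchar_ratfun : [pchar K] =i pred0.
Proof. by apply/pcharf0P => m; apply: ratfun_natr_eq0. Qed.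

(** Both halves of the theorem end here: the Mathieu-Zhao condition has only to
    be checked at [a = 0], where [b * a ^+ m = 0] as soon as [1 <= m]. *)
Lemma MZ_space_radical0 (T : {linear K -> K}) :
  (forall a, radical (lin_image T) a -> a = 0) -> MZ_space (lin_image T).
Proof.
move=> rad0; split=> [|a b /rad0->]; first exact: lin_image_subspace.
exists 1%N; split=> // -[//|m] _; exists 0.
by rewrite raddf0 expr0n mulr0.
Qed.

Lemma Ederivation_image_MZ (delta : {linear K -> K}) :
  is_Ederivation delta -> locally_finite delta -> MZ_space (lin_image delta).
Proof.
move=> [phi deltaE] lf_delta; apply: MZ_space_radical0 => a [N im_a].
apply: (@eq0_of_powers_in_image K phi N a pchar_ratfun).
  exact: Ederivation_orbit_finite deltaE lf_delta.
by move=> m /im_a[u <-]; exists u; apply: deltaE.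
Qed.

End ImageOfEderivation.

(** * Locally finite derivations vanish *)

Lemma mpoly_ring_ind (R : comNzRingType) (n : nat) (P : {mpoly R[n]} -> Prop) :
    (forall c, P c%:MP) -> (forall i, P 'X_i) ->
    (forall p q, P p -> P q -> P (p + q)) ->
    (forall p q, P p -> P q -> P (p * q)) ->
  forall p, P p.
Proof.
move=> PC PX PD PM p; have P1 : P 1 by rewrite -mpolyC1; apply: PC.
rewrite [p]mpolyE; apply: (big_ind P) => [|//|m _]; first by rewrite -mpolyC0.
rewrite -mul_mpolyC; apply: (PM) => //; rewrite mpolyXE_id.
apply: (big_ind P) => [//|p1 p2|i _]; first exact: PM.
elim: (m i) => [|t IHt]; first by rewrite expr0.
by rewrite exprS; apply: PM.
Qed.

Lemma natr_nonroot (F : fieldType) (p : {poly F}) :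
  [pchar F] =i pred0 -> p != 0 -> exists m, ~~ root p m%:R.
Proof.
move=> char_F nz_p; apply: NNPP => no_m.
pose s := [seq m%:R : F | m <- iota 0 (size p)].
suff: (size s < size p)%N by rewrite size_map size_iota ltnn.
apply: max_poly_roots => //.
  apply/allP => _ /mapP[m _ ->]; apply/negPn/negP => nroot.
  by case: no_m; exists m.
rewrite map_inj_uniq ?iota_uniq // => a b /eqP.
wlog le_ab: a b / (a <= b)%N => [IH|].
  by have /orP[|le_ba] := leq_total a b; [apply: IH | rewrite eq_sym => /IH->].
rewrite eq_sym -subr_eq0 -natrB //; move/pcharf0P: char_F => ->.
by rewrite subn_eq0 => le_ba; apply/eqP; rewrite eqn_leq le_ab.
Qed.

Section Derivation.
Variables (k : fieldType) (n : nat) (F : fieldType).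
Variables (emb : {rmorphism {mpoly k[n]} -> F}) (D : F -> F).
Hypothesis emb_inj : injective emb.
Hypothesis emb_frac : forall u, exists p q, q != 0 /\ u = emb p / emb q.
Hypothesis char_F : [pchar F] =i pred0.
Hypothesis derivD : forall u v, D (u + v) = D u + D v.
Hypothesis derivM : forall u v, D (u * v) = D u * v + u * D v.
Hypothesis derivC : forall c, D (emb c%:MP) = 0.
Hypothesis denom_orbit : forall u,
  exists2 s, s != 0 & forall m, exists r, iter m D u = emb r / emb s.

Lemma emb_eq0 p : (emb p == 0) = (p == 0).
Proof. by rewrite -(inj_eq emb_inj) rmorph0. Qed.

Lemma derivXS u m : D (u ^+ m.+1) = m.+1%:R * u ^+ m * D u.
Proof.
elim: m => [|m IHm]; first by rewrite expr1 expr0 !mul1r.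
by rewrite exprS derivM IHm -[m.+2%:R]natr1 exprS; ring.
Qed.

Lemma deriv_div u v : v != 0 -> D (u / v) = (D u - u / v * D v) / v.
Proof.
move=> nz_v; apply: (canRL (mulfK nz_v)).
have -> : D u = D (u / v) * v + u / v * D v by rewrite -derivM divfK.
by rewrite addrK.
Qed.

Section Specialization.
Variable (i : 'I_n).

(** [p] seen as a univariate polynomial in the [i]-th variable over [F], which
    contains the field of rational functions in the other variables. *)
Definition in_var : {mpoly k[n]} -> {poly F} :=
  mmap (polyC \o emb \o @mpolyC n k) (fun j => if j == i then 'X else (emb 'X_j)%:P).

HB.instance Definition _ := GRing.RMorphism.on in_var.

Lemma in_varC c : in_var c%:MP = (emb c%:MP)%:P.
Proof. exact: mmapC. Qed.

Lemma in_varX : in_var 'X_i = 'X.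
Proof. by rewrite /in_var mmapX mmap1U eqxx. Qed.

(** Substituting the [i]-th variable back recovers [p], so [in_var] is
    injective. *)
Lemma horner_in_var p : (in_var p).[emb 'X_i] = emb p.
Proof.
elim/mpoly_ring_ind: p => [c|j|p q IHp IHq|p q IHp IHq].
- by rewrite in_varC hornerC.
- rewrite /in_var mmapX mmap1U; case: eqP => [->|_]; first by rewrite hornerX.
  by rewrite hornerC.
- by rewrite rmorphD hornerD IHp IHq rmorphD.
by rewrite rmorphM hornerM IHp IHq rmorphM.
Qed.

Lemma in_var_eq0 p : (in_var p == 0) = (p == 0).
Proof.
apply/eqP/eqP => [p0|->]; last by rewrite rmorph0.
by apply: emb_inj; rewrite -horner_in_var p0 horner0 rmorph0.
Qed.

Variable c : k.
Local Notation a := (emb c%:MP).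

(** The local ring of the hyperplane where the [i]-th variable equals [c], and
    its units: fractions whose denominator (and, for units, numerator) does not
    vanish identically there. *)
Definition regular_at u :=
  exists p q, ~~ root (in_var q) a /\ u = emb p / emb q.
Definition unit_at u :=
  exists p q, [/\ ~~ root (in_var p) a, ~~ root (in_var q) a & u = emb p / emb q].

Lemma emb_nonroot_neq0 q : ~~ root (in_var q) a -> emb q != 0.
Proof. by apply: contraNneq => /eqP; rewrite emb_eq0 => /eqP->; rewrite rmorph0 root0. Qed.

Lemma nonrootM p q : ~~ root (in_var p) a -> ~~ root (in_var q) a ->
  ~~ root (in_var (p * q)) a.
Proof. by rewrite rmorphM rootM negb_or => -> ->. Qed.

Lemma nonroot1 : ~~ root (in_var 1) a.
Proof. by rewrite rmorph1 root1. Qed.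

Lemma unit_at_regular u : unit_at u -> regular_at u.
Proof. by move=> [p [q [_ nr ->]]]; exists p, q. Qed.

Lemma regular_at_emb p : regular_at (emb p).
Proof. by exists p, 1; rewrite nonroot1 rmorph1 divr1. Qed.

Lemma unit_at_nonroot p : ~~ root (in_var p) a -> unit_at (emb p).
Proof. by exists p, 1; rewrite nonroot1 rmorph1 divr1. Qed.

Lemma unit_atV u : unit_at u -> unit_at u^-1.
Proof. by move=> [p [q [nrp nrq ->]]]; exists q, p; rewrite invf_div. Qed.

Lemma regular_atD u v : regular_at u -> regular_at v -> regular_at (u + v).
Proof.
move=> [p [q [nrq ->]]] [r [s [nrs ->]]]; exists (p * s + r * q), (q * s).
by rewrite nonrootM // addf_div ?emb_nonroot_neq0 // rmorphD !rmorphM.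
Qed.

Lemma regular_atM u v : regular_at u -> regular_at v -> regular_at (u * v).
Proof.
move=> [p [q [nrq ->]]] [r [s [nrs ->]]]; exists (p * r), (q * s).
by rewrite nonrootM // mulf_div !rmorphM.
Qed.

Lemma unit_atM u v : unit_at u -> unit_at v -> unit_at (u * v).
Proof.
move=> [p [q [nrp nrq ->]]] [r [s [nrr nrs ->]]]; exists (p * r), (q * s).
by rewrite !nonrootM // mulf_div !rmorphM.
Qed.

(** The function [emb 'X_i - a] lies in the maximal ideal, which does not affect
    invertibility. *)
Lemma unit_atD u v : unit_at u -> regular_at v ->
  unit_at (u + (emb 'X_i - a) * v).
Proof.
move=> [p [q [nrp nrq ->]]] [r [s [nrs ->]]].
exists (p * s + ('X_i - c%:MP) * r * q), (q * s); rewrite nonrootM //; split=> //.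
  have := nonrootM nrp nrs; rewrite !rootE rmorphD hornerD.
  rewrite (_ : (in_var (('X_i - c%:MP) * r * q)).[a] = 0) ?addr0 //.
  by rewrite !rmorphM rmorphB /= in_varX in_varC !hornerM hornerXsubC subrr !mul0r.
by rewrite mulrA addf_div ?emb_nonroot_neq0 // rmorphD !rmorphM rmorphB.
Qed.

Hypothesis deriv_var_regular : forall j, regular_at (D (emb 'X_j)).

Lemma deriv_regular u : regular_at u -> regular_at (D u).
Proof.
have reg_emb p : regular_at (D (emb p)).
  elim/mpoly_ring_ind: p => [d|//|p q IHp IHq|p q IHp IHq].
  - by rewrite derivC -(rmorph0 emb); apply: regular_at_emb.
  - by rewrite rmorphD derivD; apply: regular_atD.
  rewrite rmorphM derivM.
  by apply: regular_atD; apply: regular_atM => //; apply: regular_at_emb.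
move=> reg_u; move: (reg_u) => [p [q [nrq def_u]]].
rewrite def_u deriv_div ?emb_nonroot_neq0 // -def_u -mulNr.
apply: regular_atM; last by apply/unit_at_regular/unit_atV/unit_at_nonroot.
apply: regular_atD => //; apply: regular_atM => //.
rewrite -mulN1r; apply: regular_atM => //.
by rewrite -(rmorphN1 emb); apply: regular_at_emb.
Qed.

Let f := emb 'X_i - a.

Lemma f_neq0 : f != 0.
Proof.
rewrite /f -rmorphB emb_eq0 -in_var_eq0 rmorphB /= in_varX in_varC.
by rewrite polyXsubC_eq0.
Qed.

Lemma deriv_f : D f = D (emb 'X_i).
Proof. by rewrite /f -rmorphN -mpolyCN derivD derivC addr0. Qed.

Hypothesis deriv_f_unit : unit_at (D (emb 'X_i)).

(** By the quotient rule [D (u / f ^+ m.+1)] is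
    [(- m.+1 * u * D f + f * D u) / f ^+ m.+2], and the new numerator is again a
    unit because [m.+1], [u] and [D f] are units.  Characteristic zero is what
    keeps [m.+1] invertible. *)
Lemma pole_order_iter_deriv m :
  exists2 u, unit_at u & iter m D f^-1 = u / f ^+ m.+1.
Proof.
elim: m => [|m [u unit_u IHm]].
  exists 1; last by rewrite expr1 mul1r.
  by rewrite -(rmorph1 emb); apply: unit_at_nonroot nonroot1.
exists (- m.+1%:R * u * D (emb 'X_i) + f * D u).
  apply: unit_atD; last exact/deriv_regular/unit_at_regular.
  do 2![apply: unit_atM => //].
  rewrite -(rmorph_nat emb) -rmorphN; apply: unit_at_nonroot.
  rewrite rmorphN rmorph_nat -polyC_natr -polyCN rootC oppr_eq0.
  by move/pcharf0P: char_F => ->.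
rewrite iterS IHm deriv_div ?expf_neq0 ?f_neq0 // derivXS deriv_f.
rewrite (exprS f m.+1) (exprS f m); field.
by rewrite f_neq0 expf_neq0 // f_neq0.
Qed.

(** The pole orders above grow without bound, whereas a common denominator [s]
    of the orbit of [f^-1] can have [f] as a factor fewer than
    [size (in_var s)] times. *)
Lemma unbounded_poles : False.
Proof.
have [s nz_s den] := denom_orbit f^-1.
pose m := size (in_var s).
have [u [p [q [nrp nrq ->]]] Eu] := pole_order_iter_deriv m.
have [r Er] := den m.
have rel : p * s = r * (q * ('X_i - c%:MP) ^+ m.+1).
  apply: emb_inj; rewrite !rmorphM rmorphXn rmorphB /= -/f.
  have nz_is : emb s != 0 by rewrite emb_eq0.
  have nz_den : emb q * f ^+ m.+1 != 0.
    by rewrite mulf_neq0 ?emb_nonroot_neq0 // expf_neq0 ?f_neq0.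
  apply/eqP; rewrite -eqr_div // -Er Eu invfM mulrA; exact: eqxx.
have: ('X - a%:P) ^+ m.+1 %| in_var p * in_var s.
  rewrite -rmorphM rel !rmorphM rmorphXn rmorphB /= in_varX in_varC.
  by rewrite !dvdp_mull.
rewrite Gauss_dvdpr; last by rewrite coprimep_expl // coprimep_sym coprimep_XsubC.
move/dvdp_leq; rewrite in_var_eq0 => /(_ nz_s).
by rewrite size_exp_XsubC ltnNge leqW.
Qed.

End Specialization.

(** If [D 'X_i] were nonzero, then at [c = t%:R] for all but finitely many [t]
    the derivation would preserve the local ring of the hyperplane and [D 'X_i]
    would be a unit there, which [unbounded_poles] excludes. *)
Lemma deriv_var_eq0 i : D (emb 'X_i) = 0.
Proof.
apply/eqP/negPn/negP => nz_Di.
have [Q nz_Q denQ] : exists2 Q, Q != 0 & forall j, exists p, D (emb 'X_j) = emb p / emb Q.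
  exact: (family_common_denominator (fun j => D (emb 'X_j)) emb_inj emb_frac).
have [p Di] := denQ i.
have nz_p : p != 0 by apply: contraNneq nz_Di => p0; rewrite Di p0 rmorph0 mul0r.
have [t] : exists t, ~~ root (in_var i (p * Q)) t%:R.
  by apply: natr_nonroot; rewrite // in_var_eq0 mulf_neq0.
rewrite -(rmorph_nat emb) -(rmorph_nat (@mpolyC n k)) rmorphM rootM negb_or.
case/andP=> nrp nrQ; apply: (@unbounded_poles i t%:R) => [j|]; last by exists p, Q.
by have [r Dj] := denQ j; exists r, Q.
Qed.

(** A derivation that kills the constants and the variables is zero. *)
Lemma locally_finite_deriv_eq0 u : D u = 0.
Proof.
have D_emb p : D (emb p) = 0.
  elim/mpoly_ring_ind: p => [//|i|p q IHp IHq|p q IHp IHq].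
  - exact: deriv_var_eq0.
  - by rewrite rmorphD derivD IHp IHq addr0.
  by rewrite rmorphM derivM IHp IHq mul0r mulr0 addr0.
have [p [q [nz_q ->]]] := emb_frac u.
by rewrite deriv_div ?emb_eq0 // !D_emb mulr0 subrr mul0r.
Qed.

End Derivation.

(** * Images of locally finite derivations *)

Section ImageOfDerivation.
Variables (k : fieldType) (n : nat).
Hypothesis char_k : [pchar k] =i pred0.
Local Notation K := (ratfun k n).

Lemma derivation_image_MZ (D : {linear K -> K}) :
  is_derivation D -> locally_finite D -> MZ_space (lin_image D).
Proof.
move=> derivM lf_D.
have D0 : forall u, D u = 0.
  apply: (@locally_finite_deriv_eq0 k n K (@frac_of k n) D).
  - exact: frac_of_inj.
  - exact: ratfunP.
  - exact: pchar_ratfun.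
  - exact: raddfD.
  - exact: derivM.
  - (* [D 1 = D (1 * 1) = D 1 + D 1], so [D] kills the constants. *)
    move=> c; have const_c : frac_of c%:MP_[n] = c *: (1 : K) by rewrite [RHS]mulr1.
    apply: etrans (congr1 D const_c) _; rewrite linearZ /=.
    have := derivM 1 1; rewrite !mulr1 mul1r => /eqP.
    by rewrite -{1}[D 1]add0r (inj_eq (addIr _)) eq_sym => /eqP->; rewrite scaler0.
  move=> u; have [s nz_s den] := common_denominator (lf_D u).
  by exists s => // m; apply: den; apply: lin_span_incl; exists m.
apply: MZ_space_radical0 => a [N /(_ _ (leqnn N))[u]].
by rewrite D0 => /esym/eqP; rewrite expf_eq0 => /andP[_ /eqP].
Qed.

End ImageOfDerivation.

Theorem corollary2p5 (k : fieldType) (hk : [pchar k] =i pred0) (n : nat) :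
  LFED_conjecture (ratfun k n).
Proof.
split=> T; first exact: derivation_image_MZ.
exact: Ederivation_image_MZ.
Qed.
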